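(* Let $w\ge -1$ be an integer. Every $\mathbf{Y}$-frieze pattern of width $w$ is the image, under the map $p_w:\operatorname{Frieze}(w)\to\operatorname{YFrieze}(w)$, of a frieze pattern of width $w$; that is, $p_w$ is surjective.
   Context: Let $w\ge -1$ be an integer. A frieze pattern $A$ of width $w$ is an integer array $(a_{i,j})_{i,j\in\mathbb{Z},\,-3\le j-i\le w+2}$ such that: (1) for all $i\in\mathbb{Z}$, $a_{i,i-3}=a_{i,i+w+2}=-1$, $a_{i,i-1}=a_{i,i+w}=1$ and $a_{i,i-2}=a_{i,i+w+1}=0$; (2) $a_{i,j}$ is a positive integer whenever $0\le j-i\le w-1$; (3) (diamond rule) $a_{i,j}a_{i+1,j+1}=1+a_{i,j+1}a_{i+1,j}$ whenever $-2\le j-i\le w+1$. The set of all of these is $\operatorname{Frieze}(w)$. A $\mathbf{Y}$-frieze pattern $B$ of width $w$ is an integer array $(b_{i,j})_{i,j\in\mathbb{Z},\,-3\le j-i\le w+2}$ such that: (1) for all $i\in\mathbb{Z}$, $b_{i,i-3}=b_{i,i-1}=b_{i,i+w}=b_{i,i+w+2}=0$ and $b_{i,i-2}=b_{i,i+w+1}=-1$; (2) $b_{i,j}$ is a positive integer whenever $0\le j-i\le w-1$; (3) ($\mathbf{Y}$-diamond rule) $b_{i,j}b_{i+1,j+1}=(1+b_{i,j+1})(1+b_{i+1,j})$ whenever $-2\le j-i\le w+1$. The set of all of these is $\operatorname{YFrieze}(w)$. The map $p_w:\operatorname{Frieze}(w)\to\operatorname{YFrieze}(w)$ sends $A=(a_{i,j})$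 to the unique $B=(b_{i,j})\in\operatorname{YFrieze}(w)$ with $b_{i,i}=a_{i,i+1}$ for all $i\in\mathbb{Z}$ (such a $B$ exists, by earlier work of de Saint Germain, and is determined by its entries $b_{i,i}$). *)

(* Defs.v *)
From HB Require Import structures.
From mathcomp Require Import all_boot all_order all_algebra.
From mathcomp Require Import mathcomp_extra boolp classical_sets functions.
From mathcomp Require Import zify ring.
Set Implicit Arguments.
Unset Strict Implicit.
Unset Printing Implicit Defensive.
Import Order.TTheory GRing.Theory Num.Theory.
Local Open Scope classical_set_scope.
Local Open Scope ring_scope.

Definition strip (w : int) :=
  {ij : int * int | -3 <= ij.2 - ij.1 <= w + 2}.

Definition array (w : int) := strip w -> int.

(* The value 0 off the strip is a dummy: the axioms below only read entries
   (i, j) with -3 <= j - i <= w + 2 (for w >= -1). *)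
Definition entry (w : int) (a : array w) (i j : int) : int :=
  if insub (i, j) is Some ij then a ij else 0.

Definition Frieze (w : int) : set (array w) :=
  [set A | let a := entry A in
    [/\ forall i : int,
          [/\ a i (i - 3) = -1 /\ a i (i + w + 2) = -1,
              a i (i - 1) = 1 /\ a i (i + w) = 1
            & a i (i - 2) = 0 /\ a i (i + w + 1) = 0],
        forall i j : int, 0 <= j - i <= w - 1 -> 0 < a i j
      & forall i j : int, -2 <= j - i <= w + 1 ->
          a i j * a (i + 1) (j + 1) = 1 + a i (j + 1) * a (i + 1) j]].

Definition YFrieze (w : int) : set (array w) :=
  [set B | let b := entry B in
    [/\ forall i : int,
          [/\ b i (i - 3) = 0 /\ b i (i - 1) = 0,
              b i (i + w) = 0 /\ b i (i + w + 2) = 0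
            & b i (i - 2) = -1 /\ b i (i + w + 1) = -1],
        forall i j : int, 0 <= j - i <= w - 1 -> 0 < b i j
      & forall i j : int, -2 <= j - i <= w + 1 ->
          b i j * b (i + 1) (j + 1) = (1 + b i (j + 1)) * (1 + b (i + 1) j)]].

Definition p_spec (w : int) (A B : array w) : Prop :=
  YFrieze B /\ forall i : int, entry B i i = entry A i (i + 1).

(* For A in Frieze w with w >= -1, such a B exists and is unique (p_exists and
   p_unique below), so that p A is this B; the default value is irrelevant. *)
Definition p (w : int) (A : array w) : array w :=
  xget (fun _ => 0) [set B | p_spec A B].

Lemma entryE (w : int) (f : int -> int -> int) (i j : int) :
  -3 <= j - i <= w + 2 ->
  entry (fun ij : strip w => f (val ij).1 (val ij).2) i j = f i j.
Proof. by move=> h; rewrite /entry; case: insubP => [u _ -> //|]; rewrite h. Qed.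

Lemma entry_val (w : int) (a : array w) (ij : strip w) :
  a ij = entry a (val ij).1 (val ij).2.
Proof. by rewrite /entry -surjective_pairing valK. Qed.

Lemma p_unique (w : int) (A B B' : array w) :
  p_spec A B -> p_spec A B' -> B = B'.
Proof.
move=> [[bdB posB YB] dB] [[bdB' posB' YB'] dB'].
have nneg (b : array w) : YFrieze b -> forall i j,
    -1 <= j - i <= w -> 0 <= entry b i j.
  case=> bd pos _ i j h.
  have [/eqP e|ne] := boolP (j == i - 1).
    by rewrite e; case: (bd i) => -[_ ->].
  have [/eqP e|ne'] := boolP (j == i + w).
    by rewrite e; case: (bd i) => _ [->].
  by apply/ltW/pos; lia.
suff E (n : nat) : forall i m : int, n%:Z - 3 = m -> m <= w + 2 ->
    entry B i (i + m) = entry B' i (i + m).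
  apply: funext => ij; rewrite !entry_val.
  case: ij => -[i j] /= h.
  have -> : j = i + (j - i) by ring.
  by apply: (E (absz (j - i + 3))); lia.
have [N] := ubnP n; elim: N n => // N IH n /ltnSE-leN i m em hm.
have [/eqP e|n3] := boolP (m == -3).
  by rewrite e; case: (bdB i) (bdB' i) => -[-> _] _ _ [[-> _] _ _].
have [/eqP e|n2] := boolP (m == -2).
  by rewrite e; case: (bdB i) (bdB' i) => _ _ [-> _] [_ _ [-> _]].
have [/eqP e|n1] := boolP (m == -1).
  by rewrite e; case: (bdB i) (bdB' i) => -[_ ->] _ _ [[_ ->] _ _].
have [/eqP e|n0] := boolP (m == 0).
  by rewrite e addr0 dB dB'.
have [/eqP e|nw1] := boolP (m == w + 1).
  by rewrite e addrA; case: (bdB i) (bdB' i) => _ _ [_ ->] [_ _ [_ ->]].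
have [/eqP e|nw2] := boolP (m == w + 2).
  by rewrite e addrA; case: (bdB i) (bdB' i) => _ [_ ->] _ [_ [_ ->] _].
have h : -2 <= (i + (m - 1)) - i <= w + 1 by lia.
have := YB _ _ h; have := YB' _ _ h.
have -> : i + (m - 1) + 1 = i + m by ring.
have E1 : entry B i (i + (m - 1)) = entry B' i (i + (m - 1)).
  by apply: (IH n.-1); lia.
have E2 : entry B (i + 1) (i + m) = entry B' (i + 1) (i + m).
  have -> : i + m = (i + 1) + (m - 1) by ring.
  by apply: (IH n.-1); lia.
have E3 : entry B (i + 1) (i + (m - 1)) = entry B' (i + 1) (i + (m - 1)).
  have -> : i + (m - 1) = (i + 1) + (m - 2) by ring.
  by apply: (IH n.-2); lia.
have P : 0 <= entry B' (i + 1) (i + (m - 1)).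
  by apply: nneg => //; lia.
rewrite E1 E2 E3 => -> /esym.
have nz : 1 + entry B' (i + 1) (i + (m - 1)) != 0 by lia.
by move=> /(mulIf nz) /addrI.
Qed.

Lemma p_exists (w : int) (A : array w) :
  -1 <= w -> Frieze A -> exists B, p_spec A B.
Proof.
move=> hw [bd pos D].
set a := entry A in bd pos D.
have a3 i j : j = i - 3 -> a i j = -1 by move=> ->; case: (bd i) => -[].
have aw2 i j : j = i + w + 2 -> a i j = -1 by move=> ->; case: (bd i) => -[].
have a1 i j : j = i - 1 -> a i j = 1 by move=> ->; case: (bd i) => _ [].
have aw i j : j = i + w -> a i j = 1 by move=> ->; case: (bd i) => _ [].
have a2 i j : j = i - 2 -> a i j = 0 by move=> ->; case: (bd i) => _ _ [].
have aw1 i j : j = i + w + 1 -> a i j = 0 by move=> ->; case: (bd i) => _ _ [].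
have nn i j : -1 <= j - i <= w -> 0 < a i j.
  move=> h; have [/eqP e|ne] := boolP (j == i - 1); first by rewrite a1.
  have [/eqP e|ne'] := boolP (j == i + w); first by rewrite aw.
  by apply: pos; lia.
pose b i j := a i (j + 1) * a (i + 1) j.
have bE i j : -3 <= j - i <= w + 2 ->
    entry (fun ij : strip w => b (val ij).1 (val ij).2) i j = b i j.
  exact: entryE.
exists (fun ij => b (val ij).1 (val ij).2); split; last first.
  by move=> i; rewrite bE ?/b ?(a1 (i + 1)) ?mulr1 //; lia.
split.
- move=> i; rewrite !bE /b; try lia; split; split.
  + by rewrite (a2 i) ?mul0r //; ring.
  + by rewrite (a2 (i + 1)) ?mulr0 //; ring.
  + by rewrite (aw1 i) ?mul0r //; ring.
  + by rewrite (aw1 (i + 1)) ?mulr0 //; ring.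
  + by rewrite (a1 i) ?(a3 (i + 1)) ?mul1r //; ring.
  + by rewrite (aw2 i) ?(aw (i + 1)) ?mulr1 //; ring.
- by move=> i j h; rewrite bE ?/b; [apply: mulr_gt0; apply: nn|]; lia.
- move=> i j h.
  have S i' j' : -3 <= j' - i' <= w + 2 -> 1 + b i' j' = a i' j' * a (i' + 1) (j' + 1).
    move=> h'; rewrite /b.
    have [/eqP e|n3] := boolP (j' == i' - 3).
      by rewrite (a2 i' (j' + 1)) ?(a3 i' j') ?(a3 (i' + 1) (j' + 1)); [ring|lia..].
    have [/eqP e|n2] := boolP (j' == i' + w + 2).
      by rewrite (aw1 (i' + 1) j') ?(aw2 i' j') ?(aw2 (i' + 1) (j' + 1)); [ring|lia..].
    by rewrite D //; lia.
  rewrite !bE; try lia.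
  by rewrite !S; [rewrite /b; ring|lia..].
Qed.

Lemma pP (w : int) (A : array w) : -1 <= w -> Frieze A -> p_spec A (p A).
Proof. by move=> hw /(p_exists hw) [B hB]; exact: (xgetI _ hB). Qed.

Lemma p_fun (w : int) : -1 <= w -> set_fun (@Frieze w) (@YFrieze w) (@p w).
Proof. by move=> hw A /(pP hw) []. Qed.

(* Main.v *)
Require Import Defs.
From mathcomp Require Import all_boot all_order all_algebra.
From mathcomp Require Import classical_sets functions.
From mathcomp Require Import zify ring.
Import Order.TTheory GRing.Theory Num.Theory.
Local Open Scope ring_scope.

(** Choose positive rationals a_i with a_i a_(i+1) = 1 + b_(i,i); they are unique
up to the twist a_i -> t^(+-1) a_i, with exponents alternating in i.  If a_(i,j)
are the continuants of a, then 1 + b_(i,j) = a_(i,j) a_(i+1,j+1), so these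
products of continuants are integers.  The key point is that this forces a_i a_j to be an
integer whenever j - i is odd: in a shortest counterexample, twist so that
a_i = 1; then at the denominator of a_j all the a_k in between are integral and
those with k - i even are even divisible by that denominator, so that two
continuants become +-1 and the integer a_(i,j-1) a_(i+1,j) is a unit times a_j,
up to integral terms.
For w even, twist so that a_(0,w) = 1; then a has the odd period w + 3 and
a_i^2 = a_i a_(i+w+3) is an integer.  For w odd, the a_(i,i+w) are polynomials in
the a_i a_j with j - i odd, hence positive integers with product 1; thus
a_(i,i+w) = 1, a is (w+3)-periodic, and twisting by the gcd of the a_i with i even
makes all the a_i integers. *)

(** * Continuants *)

(* With n = j - i + 2 this is the entry (i, j) of the frieze with quiddity
   sequence a. *)
Fixpoint cont (R : comNzRingType) (a : int -> R) (i : int) (n : nat) : R :=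
  match n with
  | 0 => 0
  | n'.+1 => match n' with
             | 0 => 1
             | n''.+1 => a (i + n''%:Z) * cont R a i n' - cont R a i n''
             end
  end.
Arguments cont {R} a i n.

Lemma contSS (R : comNzRingType) (a : int -> R) i n :
  cont a i n.+2 = a (i + n%:Z) * cont a i n.+1 - cont a i n.
Proof. by []. Qed.

Lemma cont2 (R : comNzRingType) (a : int -> R) i : cont a i 2 = a i.
Proof. by rewrite contSS /= addr0 mulr1 subr0. Qed.

(** The defining recursion read from the left end. It has order two, so the induction carries two
    consecutive indices. *)
Lemma contSSl (R : comNzRingType) (a : int -> R) i n :
  cont a i n.+2 = a i * cont a (i + 1) n.+1 - cont a (i + 2) n.
Proof.
suff [] : cont a i n.+2 = a i * cont a (i + 1) n.+1 - cont a (i + 2) n /\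
  cont a i n.+3 = a i * cont a (i + 1) n.+2 - cont a (i + 2) n.+1 by [].
elim: n => [|n [IH1 IH2]].
  by rewrite /= !addr0; split; ring.
split=> //; rewrite contSS IH2 IH1 [cont a (i + 1) n.+3]contSS.
rewrite [cont a (i + 2) n.+2]contSS.
have -> : i + 1 + n.+1%:Z = i + n.+2%:Z by lia.
have -> : i + 2 + n%:Z = i + n.+2%:Z by lia.
by ring.
Qed.

(** By the recursion, the difference of the two sides does not change when [n] grows by one. *)
Lemma cont_diamond (R : comNzRingType) (a : int -> R) i n :
  cont a i n.+1 * cont a (i + 1) n.+1
  = 1 + cont a i n.+2 * cont a (i + 1) n.
Proof.
elim: n => [|n IH]; first by rewrite /=; ring.
rewrite [cont a i n.+3]contSS [cont a (i + 1) n.+2]contSS.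
have -> : i + 1 + n%:Z = i + n.+1%:Z by lia.
apply/eqP; rewrite -subr_eq0; apply/eqP.
move/eqP: IH; rewrite -subr_eq0 => /eqP IH.
by rewrite -[RHS]IH; ring.
Qed.

Lemma cont_intr (R : comNzRingType) (z : int -> int) i n :
  cont (fun k => (z k)%:~R : R) i n = (cont z i n)%:~R.
Proof.
suff [] : cont (fun k => (z k)%:~R : R) i n = (cont z i n)%:~R /\
  cont (fun k => (z k)%:~R : R) i n.+1 = (cont z i n.+1)%:~R by [].
elim: n => [//|n [IH1 IH2]]; split=> //.
by rewrite !contSS IH1 IH2 rmorphB rmorphM.
Qed.

Lemma eq_cont (R : comNzRingType) (a a' : int -> R) i n :
  a =1 a' -> cont a i n = cont a' i n.
Proof.
move=> e; suff [] : cont a i n = cont a' i n /\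
  cont a i n.+1 = cont a' i n.+1 by [].
elim: n => [//|n [IH1 IH2]]; split=> //.
by rewrite !contSS IH1 IH2 e.
Qed.

(** * Alternating twists *)

Definition twist (t : rat) (i k : int) : rat :=
  if odd (absz (k - i)) then t^-1 else t.

Lemma odd_absS (k : int) : odd (absz (k + 1)) = ~~ odd (absz k).
Proof. by lia. Qed.

Lemma twistS t i k : t != 0 -> twist t i k * twist t i (k + 1) = 1.
Proof.
move=> t0; rewrite /twist.
have -> : k + 1 - i = k - i + 1 by ring.
by rewrite odd_absS; case: odd => /=; rewrite ?mulVf ?mulfV.
Qed.

Lemma twist_gt0 t i k : 0 < t -> 0 < twist t i k.
Proof. by rewrite /twist; case: ifP; rewrite ?invr_gt0. Qed.

(** [g] alternates between [g i] and its inverse. Each monomial of [cont a i n] comes from [n - 1]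
    consecutive factors by deleting adjacent pairs, so all monomials are scaled alike. *)
Lemma cont_twist (a g : int -> rat) :
  (forall k, g k * g (k + 1) = 1) -> forall i n,
  cont (fun k => a k * g k) i n = cont a i n * (if odd n then 1 else g i).
Proof.
move=> gS i.
have g0 k : g k != 0.
  by apply/eqP => e; have := gS k; rewrite e mul0r => /esym/eqP; rewrite oner_eq0.
have g2 k : g (k + 2) = g k.
  apply: (mulIf (g0 (k + 1))); rewrite gS mulrC.
  by have := gS (k + 1); rewrite -addrA.
have gE n : g (i + n%:Z) = if odd n then (g i)^-1 else g i.
  suff [] : g (i + n%:Z) = (if odd n then (g i)^-1 else g i) /\
    g (i + n.+1%:Z) = (if odd n.+1 then (g i)^-1 else g i) by [].
  elim: n => [|n [IH1 IH2]].
    by rewrite addr0; split=> //=; apply: (mulfI (g0 i)); rewrite gS mulfV.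
  split=> //; have -> : i + n.+2%:Z = i + n%:Z + 2 by lia.
  by rewrite g2 IH1 /= negbK.
move=> n; suff [] :
    cont (fun k => a k * g k) i n = cont a i n * (if odd n then 1 else g i) /\
    cont (fun k => a k * g k) i n.+1
    = cont a i n.+1 * (if odd n.+1 then 1 else g i) by [].
elim: n => [|n [IH1 IH2]]; first by rewrite /= mulr1 mul0r.
split=> //; rewrite !contSS IH1 IH2 gE /=; case: (odd n) => /=; last by ring.
by have := g0 i => ?; field.
Qed.

(** * Local integrality of rationals *)

(** Integrality at every prime dividing [d]. *)
Definition int_at (d : int) (x : rat) : Prop :=
  exists2 s : int, coprimez s d & s%:~R * x \is a Num.int.

Lemma int_at_of_int d x : x \is a Num.int -> int_at d x.
Proof. by exists 1; rewrite ?mul1r ?coprime1z // /coprimez gcd1z. Qed.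

Lemma int_at_mul d x y : int_at d x -> int_at d y -> int_at d (x * y).
Proof.
move=> [s cs hs] [t ct ht]; exists (s * t); first by rewrite coprimezMl cs ct.
by rewrite rmorphM /= mulrACA rpredM.
Qed.

Lemma int_at_add d x y : int_at d x -> int_at d y -> int_at d (x + y).
Proof.
move=> [s cs hs] [t ct ht]; exists (s * t); first by rewrite coprimezMl cs ct.
rewrite rmorphM /=.
have -> : s%:~R * t%:~R * (x + y) = t%:~R * (s%:~R * x) + s%:~R * (t%:~R * y) by ring.
by apply: rpredD; apply: rpredM => //; apply: intr_int.
Qed.

Lemma int_at_opp d x : int_at d x -> int_at d (- x).
Proof. by move=> [s cs hs]; exists s => //; rewrite mulrN rpredN. Qed.

Lemma int_at_sub d x y : int_at d x -> int_at d y -> int_at d (x - y).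
Proof. by move=> hx hy; apply: int_at_add => //; apply: int_at_opp. Qed.

(** [denq y] divides [s * numq y] and is coprime to both factors, hence is 1. *)
Lemma int_at_denq (y : rat) : int_at (denq y) y -> y \is a Num.int.
Proof.
move=> [s cs /intrP [k hk]].
have e : s * numq y = k * denq y.
  by apply: (@intr_inj rat); rewrite !rmorphM /= -hk numqE mulrA.
have : (denq y %| s * numq y)%Z by rewrite e dvdz_mull.
rewrite Gauss_dvdzr; last by rewrite coprimez_sym.
move=> h; have : (denq y %| gcdz (numq y) (denq y))%Z by rewrite dvdz_gcd h dvdzz.
have /eqP -> : coprimez (numq y) (denq y) by rewrite coprimezE coprime_num_den.
rewrite dvdz1 => /eqP h1; rewrite Qint_def; apply/eqP.
by have := denq_gt0 y; lia.
Qed.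

(** * Products at odd distance *)

Lemma odd_dist_mul_int (a : int -> rat) (N : nat) :
  (forall k, a k != 0) ->
  (forall i n, (n <= N)%N ->
     cont a i n.+1 * cont a (i + 1) n.+1 \is a Num.int) ->
  forall i L, (L <= N)%N -> odd L -> a i * a (i + L%:Z) \is a Num.int.
Proof.
move=> a0 H i L; have [B] := ubnP L; elim: B => // B IH in i L *.
move=> /ltnSE-leB leN oddL.
(* This twist makes [a' i] equal to 1 and turns the product in question into the single value
   [y]. *)
pose g := twist (a i)^-1 i; pose a' k := a k * g k.
have gS k : g k * g (k + 1) = 1 by apply: twistS; rewrite invr_eq0.
have gE n : g (i + n%:Z) = if odd n then a i else (a i)^-1.
  by rewrite /g /twist addrAC subrr add0r /= invrK.
have a'i : a' i = 1 by rewrite /a' /g /twist subrr /= mulfV.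
pose y := a' (i + L%:Z).
have yE : y = a i * a (i + L%:Z) by rewrite /y /a' gE oddL mulrC.
rewrite -yE; apply: int_at_denq; set d := denq y.
have Aodd k : (k < L)%N -> odd k -> int_at d (a' (i + k%:Z)).
  move=> kL ok; apply: int_at_of_int; rewrite /a' gE ok mulrC.
  by apply: IH => //; [apply: leq_trans kL _|apply: leq_trans (ltnW kL) _].
have Aeven k : (0 < k < L)%N -> ~~ odd k ->
    int_at d (a' (i + k%:Z)) /\ int_at d (y * a' (i + k%:Z)).
  move=> /andP[k0 kL] ek.
  have yint : y * a' (i + k%:Z) \is a Num.int.
    have -> : y * a' (i + k%:Z) = a (i + k%:Z) * a (i + k%:Z + (L - k)%N%:Z).
      rewrite yE /a' gE (negbTE ek).
      have -> : i + k%:Z + (L - k)%N%:Z = i + L%:Z by lia.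
      by have := a0 i => ?; field.
    by apply: IH; rewrite ?oddB ?oddL ?(negbTE ek) //; lia.
  split; last exact: int_at_of_int.
  (* [numq y] is coprime to [d], and [numq y * x = d * (y * x)], so integrality of [y * x] bounds
     the denominator of [x]. *)
  have y0 : numq y != 0 by rewrite numq_eq0 yE mulf_neq0.
  exists (numq y); first by rewrite coprimezE coprime_num_den.
  by rewrite numqE mulrAC rpredM ?intr_int.
pose M x := int_at d x /\ int_at d (y * x).
have Mmul x z : M x -> int_at d z -> M (x * z).
  by move=> [h1 h2] hz; split; rewrite ?mulrA; apply: int_at_mul.
have Msub x z : M x -> M z -> M (x - z).
  by move=> [h1 h2] [h3 h4]; split; rewrite ?mulrBr; apply: int_at_sub.
have l1 : int_at d 1 by apply: int_at_of_int.
have M0 : M 0 by split; rewrite ?mulr0; apply: int_at_of_int.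
(* M is the ideal of elements whose product with y is still integral at d: it
   contains the entries of even offset, and modulo M the relevant continuants
   are +-1. *)
pose unit1 x := int_at d x /\ exists s : bool, M (x - (-1) ^+ s).
have u1 : unit1 1 by split=> //; exists false; rewrite subrr.
have uN x z : unit1 x -> M z -> unit1 (z - x).
  move=> [hx [s hs]] hz; split; first by apply: int_at_sub => //; case: hz.
  exists (~~ s); have -> : z - x - (-1) ^+ (~~ s) = z - (x - (-1) ^+ s).
    by case: (s); ring.
  exact: Msub.
(* At an odd index the last factor has even offset from [i] and lies in [M], so raising the index by
   two only changes the sign modulo [M]. *)
have e_loc m : (m <= L)%N -> int_at d (cont a' (i + 1) m) /\
    (odd m -> unit1 (cont a' (i + 1) m)).
  have [C] := ubnP m; elim: C => // C IHm in m *.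
  case: m => [|[|m]] /ltnSE-leC hm; [by split=> //; case: M0|by split|].
  have -> : cont a' (i + 1) m.+2
      = a' (i + m.+1%:Z) * cont a' (i + 1) m.+1 - cont a' (i + 1) m.
    by rewrite contSS; congr (a' _ * _ - _); lia.
  have [h1 h1'] := IHm m.+1 ltac:(lia) ltac:(lia).
  have [h2 h2'] := IHm m ltac:(lia) ltac:(lia).
  have [om|em] := boolP (odd m).
    have hM := Aeven m.+1 ltac:(lia) ltac:(lia).
    have U := uN _ _ (h2' om) (Mmul _ _ hM h1).
    by split=> //; case: U.
  have hO := Aodd m.+1 ltac:(lia) em.
  split; last by rewrite /= negbK (negbTE em).
  by apply: int_at_sub => //; apply: int_at_mul.
(* Starting at [i], the even indices are the ones that give signs modulo [M], since the continuant
   of index 2 is [a' i = 1]. *)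
have f_loc m : (m <= L.+1)%N -> int_at d (cont a' i m) /\
    (~~ odd m -> (0 < m)%N -> unit1 (cont a' i m)).
  have [C] := ubnP m; elim: C => // C IHm in m *.
  case: m => [|[|[|m]]] /ltnSE-leC hm; [by split=> //; case: M0|by split| |].
    by rewrite cont2 a'i.
  have -> : cont a' i m.+3
      = a' (i + m.+1%:Z) * cont a' i m.+2 - cont a' i m.+1 by [].
  have [h1 h1'] := IHm m.+2 ltac:(lia) ltac:(lia).
  have [h2 h2'] := IHm m.+1 ltac:(lia) ltac:(lia).
  have [om|em] := boolP (odd m).
    have hM := Aeven m.+1 ltac:(lia) ltac:(lia).
    have U := uN _ _ (h2' ltac:(lia) ltac:(lia)) (Mmul _ _ hM h1).
    by split=> //; case: U.
  have hO := Aodd m.+1 ltac:(lia) em.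
  split; last by lia.
  by apply: int_at_sub => //; apply: int_at_mul.
have [_ [s hs]] := (e_loc L (leqnn L)).2 oddL.
have [hf [t ht]] := (f_loc L.+1 (leqnn _)).2 ltac:(lia) ltac:(lia).
have prod : cont a' i L.+1 * cont a' (i + 1) L.+1 \is a Num.int.
  rewrite !(cont_twist _ _ gS) /= oddL /= mulrACA gS mulr1; exact: H.
have [L' eL] : exists L', L = L'.+1 by exists L.-1; lia.
have yee : cont a' (i + 1) L.+1 = y * cont a' (i + 1) L - cont a' (i + 1) L'.
  by rewrite eL contSS /y; congr (a' _ * _ - _); lia.
have [e'loc _] := e_loc L' ltac:(lia).
set E := cont a' (i + 1) L in yee hs; set F := cont a' i L.+1 in prod ht hf.
have h1 : int_at d (y * E * F).
  have -> : y * E * F = F * cont a' (i + 1) L.+1 + F * cont a' (i + 1) L'.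
    by rewrite yee; ring.
  by apply: int_at_add; [exact: int_at_of_int|exact: int_at_mul].
have hsgn (u : bool) : int_at d ((-1) ^+ u) by apply: int_at_of_int; case: u.
(* [E] and [F] are signs modulo [M], so [y] agrees with [y * E * F] up to sign and terms integral at
   [d]. *)
have -> : y = (-1) ^+ s * (-1) ^+ t *
    (y * E * F - y * (E - (-1) ^+ s) * F - (-1) ^+ s * (y * (F - (-1) ^+ t))).
  by case: (s); case: (t); ring.
apply: int_at_mul; first exact: int_at_mul.
apply: int_at_sub; last by apply: int_at_mul => //; case: ht.
by apply: int_at_sub => //; apply: int_at_mul => //; case: hs.
Qed.

(** * Positive rational lifts *)

Lemma exists_quiddity (P : int -> rat) (t : rat) :
  (forall k, 0 < P k) -> 0 < t ->
  exists a : int -> rat,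
    [/\ a 0 = t, forall k, 0 < a k & forall k, a k * a (k + 1) = P k].
Proof.
move=> P0 t0.
pose f := fix f n := if n is n'.+1 then P n'%:Z / f n' else t.
(* [g n] is the value at [-n]; both recursions start from [t] at 0. *)
pose g := fix g n := if n is n'.+1 then P (Negz n') / g n' else t.
have f0 n : 0 < f n by elim: n => //= n IH; rewrite divr_gt0.
have g0 n : 0 < g n by elim: n => //= n IH; rewrite divr_gt0.
exists (fun k => match k with Posz n => f n | Negz n => g n.+1 end).
split=> // -[n|n] //.
- have -> : n%:Z + 1 = n.+1%:Z by lia.
  by rewrite /= mulrC divfK ?lt0r_neq0.
- case: n => [|n]; first by rewrite /= divfK ?lt0r_neq0.
  have -> : Negz n.+1 + 1 = Negz n by lia.
  have -> : g n.+2 = P (Negz n.+1) / g n.+1 by [].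
  by rewrite divfK ?lt0r_neq0.
Qed.

(** The offset [n - 1] runs from -1 to [w + 2]. The Y-diamond rule determines the next entry because
    [1 + b] is nonzero at offsets -1 to [w], and the products of continuants obey the same rule. *)
Lemma yfrieze_entryE (w : nat) (B : array w) (a : int -> rat) :
  YFrieze B ->
  (forall i, a i * a (i + 1) = (1 + entry B i i)%:~R) ->
  forall n i, (n <= w.+3)%N ->
  (1 + entry B i (i + n%:Z - 1))%:~R = cont a i n.+1 * cont a (i + 1) n.+1.
Proof.
move=> [bd pos D] aP n; have [N] := ubnP n; elim: N => // N IH in n *.
case: n => [|[|n]] /ltnSE-leN i hn.
- by rewrite addr0; case: (bd i) => -[_ ->] _ _; rewrite /= mulr1.
- by rewrite addrK -aP !cont2.
have c1 m k : (m <= w.+2)%N -> (m < N)%N ->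
    (entry B k (k + m%:Z - 1))%:~R = cont a k m.+2 * cont a (k + 1) m.
  move=> hm hm'; apply: (addrI 1); rewrite -cont_diamond -IH ?rmorphD //; lia.
have := D i (i + n%:Z); rewrite addrAC subrr add0r => /(_ ltac:(lia)).
move=> /(congr1 (fun z : int => z%:~R : rat)); rewrite !intrM.
have -> : i + n%:Z = i + n.+1%:Z - 1 by lia.
rewrite c1; [|lia..].
have -> : i + n.+1%:Z - 1 + 1 = (i + 1) + n.+1%:Z - 1 by lia.
rewrite c1; [|lia..].
have -> : i + n.+1%:Z - 1 = i + 1 + n%:Z - 1 by lia.
have -> : i + 1 + n.+1%:Z - 1 = i + n.+2%:Z - 1 by lia.
have nz : (1 + entry B (i + 1) (i + 1 + n%:Z - 1))%:~R != 0 :> rat.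
  rewrite intr_eq0.
  have [/eqP e|n0] := boolP (n == 0).
    by rewrite e addr0; case: (bd (i + 1)) => -[_ ->].
  have [/eqP e|nw] := boolP (n == w.+1).
    have -> : i + 1 + n%:Z - 1 = i + 1 + w%:Z by rewrite e; lia.
    by case: (bd (i + 1)) => _ [->].
  by have := pos (i + 1) (i + 1 + n%:Z - 1) ltac:(lia); lia.
move=> e; apply: (mulIf nz); rewrite -e.
rewrite IH; [|lia..].
by ring.
Qed.

(** A positive entry of [B] is a product of continuants whose indices differ by two, so positivity
    climbs two indices at a time. The zero border at offset [w] gives the product 1, and the diamond
    rule with positivity then gives the vanishing. *)
Lemma yfrieze_lift (w : nat) (B : array w) (a : int -> rat) :
  YFrieze B -> (forall k, 0 < a k) ->
  (forall i, a i * a (i + 1) = (1 + entry B i i)%:~R) ->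
  [/\ forall i n, (0 < n <= w.+2)%N -> 0 < cont a i n,
      forall i, cont a i w.+2 * cont a (i + 1) w.+2 = 1,
      forall i, cont a i w.+3 = 0
    & forall i L, (L <= w.+3)%N -> odd L -> a i * a (i + L%:Z) \is a Num.int].
Proof.
move=> YB a0 aP; have E := yfrieze_entryE _ _ _ YB aP.
have [bd pos _] := YB.
have cpos i n : (0 < n <= w.+2)%N -> 0 < cont a i n.
  have [N] := ubnP n; elim: N => // N IH in n i *.
  case: n => [|[|[|n]]] /ltnSE-leN hn //; first by rewrite cont2.
  have := E n.+1 i ltac:(lia); rewrite cont_diamond rmorphD /=.
  move=> /addrI e; have h := IH n.+1 (i + 1) ltac:(lia) ltac:(lia).
  by rewrite -(pmulr_lgt0 _ h) -e ltr0z; apply: pos; lia.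
have bw i : entry B i (i + w.+1%:Z - 1) = 0.
  have -> : i + w.+1%:Z - 1 = i + w%:Z by lia.
  by case: (bd i) => _ [].
have c1 i : cont a i w.+2 * cont a (i + 1) w.+2 = 1.
  by rewrite -E; [rewrite bw addr0|lia].
split=> //.
- move=> i; have := c1 i; rewrite cont_diamond -[X in _ = X]addr0 => /addrI/eqP.
  by rewrite mulf_eq0 (gt_eqF (cpos (i + 1) w.+1 _)) ?orbF; [move/eqP|lia].
- apply: odd_dist_mul_int => [k|i n hn]; first by rewrite gt_eqF.
  by rewrite -E // intr_int.
Qed.

(** * Periodicity and integrality tools *)

(** Expanding one vanishing continuant from the left and another from the right shows that both
    values are [cont a (i + 2) w.+1]. *)
Lemma cont_period (w : nat) (a : int -> rat) :
  (forall i, cont a i w.+2 = 1) -> (forall i, cont a i w.+3 = 0) ->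
  forall i, a (i + w.+3%:Z) = a i.
Proof.
move=> c1 c0 i.
have := c0 i; rewrite contSSl c1 mulr1 => /subr0_eq ->.
have := c0 (i + 2); rewrite contSS c1 mulr1 => /subr0_eq <-.
by congr a; lia.
Qed.

Lemma int_of_mulxx (x : rat) : x * x \is a Num.int -> x \is a Num.int.
Proof.
move=> /intrP [k hk]; apply: int_at_denq.
exists (numq x); first by rewrite coprimezE coprime_num_den.
by rewrite numqE mulrAC hk rpredM ?intr_int.
Qed.

(** Deleting adjacent pairs leaves indices of alternating parity, so the monomials split into
    products at odd distance. The induction also carries the even-index continuants, times one later
    factor of odd offset. *)
Lemma cont_int_odd (a : int -> rat) i m :
  (forall k l : nat, (k < l)%N -> (l.+1 < m)%N -> odd (l - k) ->
     a (i + k%:Z) * a (i + l%:Z) \is a Num.int) ->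
  odd m -> cont a i m \is a Num.int.
Proof.
move=> H om.
suff h n : (n <= m)%N ->
    (odd n -> cont a i n \is a Num.int) /\
    (~~ odd n -> forall l : nat, (n <= l.+1)%N -> (l.+1 < m)%N -> odd l ->
       a (i + l%:Z) * cont a i n \is a Num.int).
  by have [h1 _] := h m (leqnn _); exact: h1.
have [N] := ubnP n; elim: N => // N IH in n *.
case: n => [|[|n]] /ltnSE-leN hn.
- by split=> // _ l _ _ _; rewrite mulr0.
- by split.
have [h1 h1'] := IH n ltac:(lia) ltac:(lia).
have [h2 h2'] := IH n.+1 ltac:(lia) ltac:(lia).
rewrite contSS; split=> [on|on l nl lm ol].
  by rewrite rpredB ?h1 ?h2' //; lia.
rewrite mulrBr rpredB ?h1' //; try lia.
rewrite mulrA rpredM ?h2 //; last lia.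
by rewrite mulrC; apply: H; lia.
Qed.

(** [g] generates the additive subgroup of the rationals spanned by [s]; the last clause is the form
    in which its being an integer combination of [s] is needed. *)
Lemma seq_gcd (s : seq rat) : exists2 g : rat, 0 <= g &
  (forall x, x \in s -> exists k : int, x = k%:~R * g) /\
  (forall y, (forall x, x \in s -> x * y \is a Num.int) -> g * y \is a Num.int).
Proof.
elim: s => [|x s [g g0 [h1 h2]]].
  by exists 0 => //; split=> // y _; rewrite mul0r.
pose d := denq x * denq g; pose u := numq x * denq g; pose v := numq g * denq x.
have d0 : 0 < d by rewrite mulr_gt0 ?denq_gt0.
have dr0 : d%:~R != 0 :> rat by rewrite intr_eq0 gt_eqF.
have xE : x = u%:~R / d%:~R.
  by apply: (mulIf dr0); rewrite divfK // /u /d !rmorphM /= numqE; ring.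
have gE : g = v%:~R / d%:~R.
  by apply: (mulIf dr0); rewrite divfK // /v /d !rmorphM /= numqE; ring.
move: u v d d0 dr0 xE gE => u v d d0 dr0 xE gE.
have [[p q] pq] : exists pq : int * int, pq.1 * u + pq.2 * v = gcdz u v.
  by have [p [q e]] := Bezoutz u v; exists (p, q).
rewrite /= in pq.
exists ((gcdz u v)%:~R / d%:~R).
  by rewrite divr_ge0 ?ler0z // ltW.
have gu : u = (u %/ gcdz u v)%Z * gcdz u v by rewrite divzK ?dvdz_gcdl.
have gv : v = (v %/ gcdz u v)%Z * gcdz u v by rewrite divzK ?dvdz_gcdr.
split=> [y|y hy].
- rewrite inE => /orP[/eqP -> {y}|/h1 [k ->]].
    by exists (u %/ gcdz u v)%Z; rewrite xE {1}gu intrM mulrA.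
  by exists (k * (v %/ gcdz u v)%Z); rewrite gE {1}gv !intrM !mulrA.
- rewrite -pq intrD !intrM.
  have -> : (p%:~R * u%:~R + q%:~R * v%:~R) / d%:~R * y
      = p%:~R * (x * y) + q%:~R * (g * y) by rewrite xE gE; field.
  apply: rpredD; apply: rpredM; rewrite ?intr_int //.
    by apply: hy; rewrite mem_head.
  by apply: h2 => z zs; apply: hy; rewrite inE zs orbT.
Qed.

Lemma period_mulz (T : Type) (f : int -> T) (m : int) :
  (forall i, f (i + m) = f i) -> forall (q : int) i, f (i + q * m) = f i.
Proof.
move=> H; have Hn (n : nat) i : f (i + n%:Z * m) = f i.
  elim: n => [|n IH]; first by rewrite mul0r addr0.
  by rewrite -IH -[RHS]H; congr f; rewrite intS; ring.
case=> n i //; rewrite -[LHS](Hn n.+1); congr f; rewrite NegzE; ring.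
Qed.

Lemma mul_succ_eq1 (c : int -> rat) :
  (forall i, c i * c (i + 1) = 1) -> c 0 = 1 -> forall i, c i = 1.
Proof.
move=> H c0.
have S i : c i = 1 <-> c (i + 1) = 1.
  by split=> e; have := H i; rewrite e ?mul1r ?mulr1.
case; elim=> [|n IH] //.
- have -> : n.+1%:Z = n%:Z + 1 by lia.
  exact: (S _).1.
- exact: (S (-1)).2.
- apply: (S _).2.
  by have -> : Negz n.+1 + 1 = Negz n by lia.
Qed.

(** * The integral lift *)

Lemma exists_int_lift (w : nat) (B : array w) : YFrieze B ->
  exists a : int -> rat,
    [/\ forall k, 0 < a k,
        forall i, a i * a (i + 1) = (1 + entry B i i)%:~R,
        forall i, cont a i w.+2 = 1
      & forall i, a i \is a Num.int].
Proof.
move=> YB; have [bd pos _] := YB.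
have P0 i : 0 < (1 + entry B i i)%:~R :> rat.
  (* For [w = 0] the diagonal is the zero border. *)
  rewrite ltr0z; have [/eqP e|w0] := boolP (w == 0).
    have {2}-> : i = i + w%:Z by lia.
    by case: (bd i) => _ [->].
  by have := pos i i ltac:(lia); lia.
have [a [_ a0 aP]] := exists_quiddity _ 1 P0 ltr01.
have [cpos c1 c0 aint] := yfrieze_lift _ _ _ YB a0 aP.
have twisted t : 0 < t -> let a' k := a k * twist t 0 k in
    [/\ forall k, 0 < a' k,
        forall i, a' i * a' (i + 1) = (1 + entry B i i)%:~R
      & forall i n,
          cont a' i n = cont a i n * (if odd n then 1 else twist t 0 i)].
  move=> t0 a'; have gS k := twistS t 0 k (lt0r_neq0 t0).
  split=> [k|i|i n]; first by rewrite mulr_gt0 ?twist_gt0.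
    by rewrite mulrACA gS mulr1.
  exact: cont_twist.
have [ow|ew] := boolP (odd w).
- have ca1 i : cont a i w.+2 = 1.
    have cint k : cont a k w.+2 \is a Num.int.
      apply: cont_int_odd; last by rewrite /= negbK.
      move=> l m lm mw o; have -> : k + m%:Z = k + l%:Z + (m - l)%N%:Z by lia.
      by apply: aint => //; lia.
    have := c1 i; have := cpos i w.+2 ltac:(lia).
    have := cpos (i + 1) w.+2 ltac:(lia).
    have /intrP [x ->] := cint i; have /intrP [y ->] := cint (i + 1).
    rewrite -intrM !ltr0z => y0 x0 xy1.
    have xy : x * y = 1 by apply: (@intr_inj rat).
    have -> : x = 1 by nia.
    by [].
  (* The even-indexed values of one period: dividing by their generator [g] makes them integral, and
     [g * a r] is integral for odd [r] because each [x * a r] with [x] in [s] is a product at odd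
     distance. *)
  pose s := [seq a k%:Z | k <- iota 0 w.+3 & ~~ odd k].
  have [g g0 [gs gy]] := seq_gcd s.
  have {}g0 : 0 < g.
    rewrite lt_neqAle g0 andbT eq_sym; apply/eqP => e.
    have [|k] := gs (a 0); last by rewrite e mulr0; apply/eqP; rewrite gt_eqF.
    by apply/mapP; exists 0%N => //.
  have [a'0 a'P a'c] := twisted g^-1 ltac:(by rewrite invr_gt0).
  exists (fun k => a k * twist g^-1 0 k); split=> // [i|].
    by rewrite a'c ca1 /= negbK ow mulr1.
  set a' := fun k => _ in a'0 a'P a'c *.
  have [_ _ c'0 _] := yfrieze_lift _ _ _ YB a'0 a'P.
  have per := cont_period w a' _ c'0.
  move=> i; rewrite -/(a' i) (divz_eq i w.+3%:Z) addrC (period_mulz _ a'); last first.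
    by apply: per => k; rewrite a'c ca1 /= negbK ow mulr1.
  have [r -> rw] : exists2 r : nat, (i %% w.+3%:Z)%Z = r%:Z & (r < w.+3)%N.
    by exists (absz (i %% w.+3%:Z)%Z); lia.
  rewrite /a' /twist subr0 absz_nat; case: ifP => odd_r.
    rewrite invrK mulrC; apply: gy => x /mapP [k]; rewrite mem_filter mem_iota.
    move=> hk ->; have [kr|rk] := leqP k r.
      have -> : r%:Z = k%:Z + (r - k)%N%:Z by lia.
      by apply: aint; lia.
    have -> : k%:Z = r%:Z + (k - r)%N%:Z by lia.
    by rewrite mulrC; apply: aint; lia.
  have [|k ->] := gs (a r%:Z).
    by apply/mapP; exists r => //; rewrite mem_filter mem_iota odd_r.
  by rewrite mulfK ?gt_eqF // intr_int.
- have k0 := cpos 0 w.+2 ltac:(lia).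
  (* The index [w + 2] is even, so this twist makes the continuant at 0 equal to 1; the product
     relation spreads this to all positions. *)
  have [a'0 a'P a'c] := twisted (cont a 0 w.+2)^-1 ltac:(by rewrite invr_gt0).
  exists (fun k => a k * twist (cont a 0 w.+2)^-1 0 k).
  set a' := fun k => _ in a'0 a'P a'c *.
  have [_ c'1 c'0 a'int] := yfrieze_lift _ _ _ YB a'0 a'P.
  have ca'1 := mul_succ_eq1 _ c'1.
  have {}ca'1 i : cont a' i w.+2 = 1.
    apply: ca'1; rewrite a'c /= negbK (negbTE ew) /twist subrr /= mulfV //.
    by rewrite gt_eqF.
  split=> // i; rewrite -/(a' i); apply: int_of_mulxx.
  by rewrite -{2}(cont_period w a' ca'1 c'0 i); apply: a'int; rewrite //= negbK.
Qed.

(** * Surjectivity *)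

Theorem theoremA (w : int) (hw : -1 <= w) :
  set_surj (@Frieze w) (@YFrieze w) (@p w).
Proof.
move=> B YB.
suff [A FA AB] : exists2 A : array w, Frieze A &
    forall i, entry B i i = entry A i (i + 1).
  by exists A => //; apply: p_unique (pP hw FA) _.
case: w hw B YB => [w|[|//]] hw B YB; last first.
  (* For [w = -1] every entry is prescribed by the border conditions and depends only on the offset
     [m]. *)
  pose f (m : int) : int := if m == -3 then -1 else if m == -1 then 1
    else if m == 1 then -1 else 0.
  exists (fun ij => f ((val ij).2 - (val ij).1)).
    have E i j : -3 <= j - i <= 1 ->
        entry (fun ij : strip (-1) => f ((val ij).2 - (val ij).1)) i j
        = f (j - i).
      by move=> h; rewrite (@entryE (-1) (fun i j => f (j - i))) //; lia.
    split=> [i|i j|i j]; rewrite /= ?NegzE.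
    + by rewrite !E /f; try lia; do !split; do !case: ifP; lia.
    + by lia.
    + by move=> h; rewrite !E /f; try lia; do !case: ifP; lia.
  move=> i; rewrite (@entryE _ (fun i j => f (j - i))); last by lia.
  have -> : f (i + 1 - i) = -1 by rewrite addrAC subrr.
  have {2}-> : i = i + Negz 0 + 1 by lia.
  by case: YB => bd _ _; case: (bd i) => _ _ [].
have [a [a0 aP c1 aint]] := exists_int_lift _ _ YB.
have [cpos _ c0 _] := yfrieze_lift _ _ _ YB a0 aP.
pose z k := numq (a k).
have zE : a =1 fun k => (z k)%:~R.
  by move=> k; have := aint k; rewrite /z numqE Qint_def => /eqP ->; rewrite mulr1.
have cE i n : cont a i n = (cont z i n)%:~R.
  by rewrite (eq_cont _ _ _ _ _ zE) cont_intr.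
have z1 i : cont z i w.+2 = 1 by apply: (@intr_inj rat); rewrite -cE c1.
have z0 i : cont z i w.+3 = 0 by apply: (@intr_inj rat); rewrite -cE c0.
have zpos i n : (0 < n <= w.+2)%N -> 0 < cont z i n.
  by move=> h; rewrite -(ltr0z rat) -cE cpos.
have zP i : z i * z (i + 1) = 1 + entry B i i.
  by apply: (@intr_inj rat); rewrite intrM -!zE.
(* Offset -3 would be the continuant of index -1, so its value -1 is set by hand. *)
pose f (i j : int) := if j - i == -3 then -1 else cont z i (absz (j - i + 2)).
have fE i (n : nat) j : j = i + n%:Z - 2 -> f i j = cont z i n.
  move=> ->; rewrite /f ifF; last by lia.
  by congr cont; lia.
have E i j : -3 <= j - i <= w%:Z + 2 ->
    entry (fun ij : strip w => f (val ij).1 (val ij).2) i j = f i j.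
  exact: entryE.
exists (fun ij => f (val ij).1 (val ij).2); last first.
  move=> i; rewrite E; last by lia.
  rewrite (fE _ 3); last by lia.
  apply: (addrI 1); rewrite -zP -(cont2 _ z i) -(cont2 _ z (i + 1)).
  by rewrite cont_diamond [cont z (i + 1) 1]/= mulr1.
split=> [i|i j h|i j h].
- rewrite !E; try lia.
  rewrite [f i (i - 3)]/f [i - 3 - i]addrAC subrr add0r /=.
  rewrite (fE i w.+4 (i + w + 2)) ?(fE i 1 (i - 1)) ?(fE i w.+2 (i + w)); try lia.
  rewrite (fE i 0 (i - 2)) ?(fE i w.+3 (i + w + 1)); try lia.
  by rewrite contSS z0 z1 mulr0 sub0r.
- rewrite E; last by lia.
  by rewrite (fE _ (absz (j - i + 2))); [apply: zpos|]; lia.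
- rewrite !E; try lia.
  (* The only diamonds that involve offset -3, out of reach of [cont_diamond]. *)
  have [e|n2] := eqVneq j (i - 2).
    rewrite (fE i 0 j) ?(fE i 1 (j + 1)); try lia.
    by rewrite [f (i + 1) j]/f ifT; [rewrite /= mul0r|lia].
  have [n hn] : exists n : nat, j = i + n%:Z - 1 by exists (absz (j - i + 1)); lia.
  rewrite (fE i n.+1 j) ?(fE (i + 1) n.+1 (j + 1)); try lia.
  rewrite ?(fE i n.+2 (j + 1)) ?(fE (i + 1) n j); try lia.
  exact: cont_diamond.
Qed.
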